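(* There exists a countable, connected, arc transitive graph $G$ with infinite motion such that for no finite set $C$ does $G$ admit a distinguishing $C$-colouring of its vertex set.
   Context: All graphs are simple and undirected. A graph is arc transitive if its automorphism group acts transitively on ordered pairs $(u,v)$ of adjacent vertices. The motion of an automorphism $\varphi$ is the number (possibly infinite) of vertices $v$ with $\varphi(v)\neq v$; a graph has infinite motion if every non-identity automorphism has infinite motion. For a set $C$, a $C$-colouring of the vertex set $V$ is a map $c\colon V\to C$; an automorphism $\varphi$ preserves $c$ if $c(\varphi(v))=c(v)$ for all $v\in V$; the colouring is distinguishing if the identity is the only automorphism preserving it. *)

(* Defs.v *)
From mathcomp Require Import all_boot.
From Stdlib Require Import List Relation_Operators.

Definition simple_graph {V : Type} (adj : V -> V -> Prop) : Prop :=
  (forall u v, adj u v -> adj v u) /\ (forall v, ~ adj v v).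

Definition countable_type (V : Type) : Prop :=
  exists f : V -> nat, injective f.

Definition connected_graph {V : Type} (adj : V -> V -> Prop) : Prop :=
  forall u v : V, clos_refl_trans V adj u v.

Definition automorphism {V : Type} (adj : V -> V -> Prop) (phi : V -> V) : Prop :=
  bijective phi /\ (forall u v, adj u v <-> adj (phi u) (phi v)).

Definition arc_transitive {V : Type} (adj : V -> V -> Prop) : Prop :=
  forall u v u' v', adj u v -> adj u' v' ->
    exists phi, automorphism adj phi /\ phi u = u' /\ phi v = v'.

Definition finite_vset {V : Type} (P : V -> Prop) : Prop :=
  exists l : list V, forall v, P v -> List.In v l.

Definition infinite_motion {V : Type} (adj : V -> V -> Prop) : Prop :=
  forall phi, automorphism adj phi -> (exists v, phi v <> v) ->
    ~ finite_vset (fun v => phi v <> v).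

Definition preserves_colouring {V C : Type} (phi : V -> V) (c : V -> C) : Prop :=
  forall v, c (phi v) = c v.

Definition distinguishing {V C : Type} (adj : V -> V -> Prop) (c : V -> C) : Prop :=
  forall phi, automorphism adj phi -> preserves_colouring phi c -> forall v, phi v = v.

(* Main.v *)
Require Import Defs.
From mathcomp Require Import all_boot.
From mathcomp Require Import all_order all_algebra.
From mathcomp Require Import ring lra.
From Stdlib Require Import Relation_Operators.
From Stdlib Require Import Classical IndefiniteDescription.

(** The graph is the bipartite comparability graph on two copies of the
    rationals: [q] in the lower copy is adjacent to [r] in the upper copy iff
    [q < r].  Affine maps, which exchange the two copies when they are
    decreasing, make it arc transitive.  The neighbourhoods of two distinct
    vertices differ in infinitely many vertices, so no automorphism other than
    the identity has finite motion.  A finite colouring of the vertices is a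
    finite colouring of the rationals; on some interval every colour that occurs
    at all occurs densely (otherwise pass to a subinterval that misses a colour),
    and a back-and-forth construction inside this interval yields a nontrivial
    order automorphism preserving the colours. *)

Set Implicit Arguments.
Unset Strict Implicit.
Unset Printing Implicit Defensive.

Import Order.TTheory GRing.Theory Num.Theory.
Local Open Scope ring_scope.

(** * Intervals on which every occurring colour is dense *)

Definition colours_dense (D : Type) (c : rat -> D) (a b : rat) : Prop :=
  forall x, a < x < b ->
  forall l u, a <= l -> l < u -> u <= b -> exists2 y, l < y < u & c y = c x.

Lemma exists_colours_dense (D : finType) (c : rat -> D) :
  exists a b, a < b /\ colours_dense c a b.
Proof.
(* Induction on a bound for the size of a set [A] containing every colour of the interval. A colour
   missed by a subinterval is removed from [A] there. *)
suff IH n (A : {set D}) a b : (#|A| <= n)%N -> a < b ->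
    (forall x, a < x < b -> c x \in A) ->
    exists a' b', a' < b' /\ colours_dense c a' b'.
  by apply: (IH #|[set: D]| [set: D] 0 1) => // x _; rewrite inE.
elim: n A a b => [|n IH] A a b cardA ltab cA.
  have : c ((a + b) / 2) \in A by apply: cA; lra.
  by move: cardA; rewrite leqn0 cards_eq0 => /eqP->; rewrite inE.
have [[x [l [u [xab al lu ub avoid]]]]|no_gap] := classic (exists x l u,
    [/\ a < x < b, a <= l, l < u, u <= b & forall y, l < y < u -> c y <> c x]).
  apply: (IH (A :\ c x) l u) => // [|y ylu].
    by move: cardA; rewrite (cardsD1 (c x) A) cA.
  rewrite !inE; apply/andP; split; last by apply: cA; lra.
  by apply/eqP; apply: avoid.
exists a, b; split=> // x xab l u al lu ub; apply: NNPP => none.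
by apply: no_gap; exists x, l, u; split=> // y ylu cyx; apply: none; exists y.
Qed.

(** * Colour-preserving back-and-forth *)

Lemma exists_maximum (s : seq rat) (x0 : rat) :
  exists2 m, m \in x0 :: s & forall x, x \in x0 :: s -> x <= m.
Proof.
elim: s x0 => [|y s IH] x0.
  by exists x0 => [|x]; rewrite inE // => /eqP->.
have [m ms maxm] := IH y; have [lexm|ltmx] := leP x0 m.
  exists m => [|x]; first by rewrite inE ms orbT.
  by rewrite inE => /orP[/eqP->|/maxm].
exists x0 => [|x]; first by rewrite inE eqxx.
by rewrite inE => /orP[/eqP->//|/maxm lexm]; apply: le_trans lexm (ltW _).
Qed.

Lemma exists_minimum (s : seq rat) (x0 : rat) :
  exists2 m, m \in x0 :: s & forall x, x \in x0 :: s -> m <= x.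
Proof.
have [m ms maxm] := exists_maximum (map -%R s) (- x0).
have memN x : (x \in - x0 :: map -%R s) = (- x \in x0 :: s).
  by rewrite -{1}[x]opprK -map_cons mem_map //; apply: oppr_inj.
exists (- m) => [|x xs]; first by rewrite -memN.
by rewrite lerNl; apply: maxm; rewrite memN opprK.
Qed.

Section BackAndForth.

Variables (D : Type) (c : rat -> D) (a b : rat).
Hypothesis dense : colours_dense c a b.

(** With both comparisons, equal first coordinates force equal second ones and conversely, so a
    partial isomorphism is single-valued and injective. *)
Definition order_compatible (p q : rat * rat) : Prop :=
  (p.1 < q.1) = (p.2 < q.2) /\ (q.1 < p.1) = (q.2 < p.2).

(** Outside the open interval the map has to be the identity, so the final map is defined on all of
    [rat]. *)
Definition admissible_pair (p : rat * rat) : Prop :=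
  c p.1 = c p.2 /\
  ((a < p.1 < b /\ a < p.2 < b) \/ (~~ (a < p.1 < b) /\ p.1 = p.2)).

Definition partial_iso (s : seq (rat * rat)) : Prop :=
  (forall p, p \in s -> admissible_pair p) /\
  (forall p q, p \in s -> q \in s -> order_compatible p q).

Definition swap (p : rat * rat) := (p.2, p.1).

Lemma swapK : involutive swap. Proof. by case. Qed.

Lemma mem_map_swap (s : seq (rat * rat)) p : (p \in map swap s) = (swap p \in s).
Proof. by rewrite -{1}[p]swapK mem_map //; apply: inv_inj swapK. Qed.

Lemma partial_iso_swap s : partial_iso s -> partial_iso (map swap s).
Proof.
move=> [adm cmp]; split=> [p|p q]; rewrite !mem_map_swap.
  move=> /adm[/= cp [[? ?]|[out eqp]]]; split=> //; first by left.
  by right; rewrite -eqp.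
by move=> ps qs; have [] := cmp _ _ ps qs.
Qed.

Lemma partial_iso_cons s p : partial_iso s -> admissible_pair p ->
  (forall q, q \in s -> order_compatible p q) -> partial_iso (p :: s).
Proof.
move=> [adm cmp] admp cmpp; split=> [q|q r]; rewrite !inE.
  by move=> /orP[/eqP->|/adm].
move=> /orP[/eqP->|qs] /orP[/eqP->|rs]; [|exact: cmpp| |exact: cmp].
  by split; rewrite !ltxx.
by have [? ?] := cmpp _ qs; split.
Qed.

(** Only finitely many images constrain that of a new interior point [x]. They leave a gap of
    positive length, in which density supplies a point coloured like [x]. *)
Lemma partial_iso_forth s x : partial_iso s ->
  exists y, partial_iso ((x, y) :: s).
Proof.
move=> isos; have [adm cmp] := isos.
have [xI|xNI] := boolP (a < x < b); last first.
  exists x; apply: partial_iso_cons => // [|q qs]; first by split=> //; right.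
  have [_ [[/andP[? ?] /andP[? ?]]|[_ eqq]]] := adm _ qs.
    by split => /=; apply/idP/idP; move: xNI; rewrite negb_and -!leNgt; lra.
  by rewrite /order_compatible -eqq.
have [[q qs /= qx]|fresh] := classic (exists2 q, q \in s & q.1 = x).
  exists q.2; rewrite -qx -surjective_pairing.
  by apply: partial_iso_cons => // [|r rs]; [exact: adm|exact: cmp].
(* The gap is bounded by the largest image from the left of [x] and the smallest from the right; [a]
   and [b] are the bounds if there is none. *)
pose below := [seq q.2 | q <- s & a < q.1 < x].
pose above := [seq q.2 | q <- s & x < q.1 < b].
have [l lS maxl] := exists_maximum below a.
have [u uS minu] := exists_minimum above b.
have belowP z : z \in below -> exists2 q, q \in s & q.2 = z /\ a < q.1 < x.
  move=> /mapP[q]; rewrite mem_filter => /andP[? ?] ->.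
  by exists q.
have aboveP z : z \in above -> exists2 q, q \in s & q.2 = z /\ x < q.1 < b.
  move=> /mapP[q]; rewrite mem_filter => /andP[? ?] ->.
  by exists q.
have al : a <= l by apply: maxl; rewrite inE eqxx.
have ub : u <= b by apply: minu; rewrite inE eqxx.
have inI q : q \in s -> a < q.1 < b -> a < q.2 < b.
  by move=> qs qI; have [_ [[]|[]]] := adm _ qs; rewrite ?qI.
have lu : l < u.
  move: lS uS; rewrite !inE => /orP[/eqP->|/belowP[q qs [<- qx]]].
    move=> /orP[/eqP->|/aboveP[r rs [<- rx]]]; first by lra.
    by have /andP[] : a < r.2 < b by apply: inI => //; lra.
  move=> /orP[/eqP->|/aboveP[r rs [<- rx]]].
    by have /andP[] : a < q.2 < b by apply: inI => //; lra.
  by have [<- _] := cmp _ _ qs rs; lra.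
have [y ylu cyx] := dense xI al lu ub.
have yI : a < y < b by lra.
exists y; apply: partial_iso_cons => // [|q qs]; first by split; [|left].
have [_ [[qI1 qI2]|[qNI eqq]]] := adm _ qs; last first.
  rewrite /order_compatible /= -eqq; move: qNI; rewrite negb_and -!leNgt => qNI.
  by split; apply/idP/idP; lra.
have [ltqx|ltxq|eqqx] := ltgtP q.1 x; last by case: fresh; exists q.
- have leql : q.2 <= l.
    apply: maxl; rewrite inE; apply/orP; right; apply/mapP; exists q => //.
    by rewrite mem_filter ltqx qs !andbT; case/andP: qI1.
  by split => /=; apply/idP/idP; lra.
- have leuq : u <= q.2.
    apply: minu; rewrite inE; apply/orP; right; apply/mapP; exists q => //.
    by rewrite mem_filter ltxq qs andbT; case/andP: qI1.
  by split => /=; apply/idP/idP; lra.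
Qed.

(** The conditions on pairs are symmetric in the two coordinates, so this is the forth step
    conjugated by [swap]. *)
Lemma partial_iso_back s y : partial_iso s ->
  exists x, partial_iso ((x, y) :: s).
Proof.
move=> /partial_iso_swap/(partial_iso_forth y)[x /partial_iso_swap iso].
by exists x; move: iso; rewrite /= mapK //; apply: swapK.
Qed.

Lemma partial_iso_extend s x : partial_iso s -> exists t,
  [/\ partial_iso t, {subset s <= t},
      exists y, (x, y) \in t & exists z, (z, x) \in t].
Proof.
move=> /(partial_iso_forth x)[y iso].
have [z iso'] := partial_iso_back x iso.
exists ((z, x) :: (x, y) :: s); split=> // [p ps||].
- by rewrite !inE ps !orbT.
- by exists y; rewrite !inE eqxx orbT.
- by exists z; rewrite inE eqxx.
Qed.

Lemma partial_iso_total s0 : partial_iso s0 ->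
  exists f g : rat -> rat,
    [/\ cancel f g, cancel g f, {mono f : x y / x < y},
        forall x, c (f x) = c x & forall p, p \in s0 -> f p.1 = p.2].
Proof.
move=> iso0.
(* The hypothesis [partial_iso] sits under the existential, so that choice gives a [next] defined on
   all lists. Stage [n] treats the rational with code [n], if there is one. *)
have /functional_choice[next nextP] (ns : nat * seq (rat * rat)) : exists t,
    partial_iso ns.2 -> [/\ partial_iso t, {subset ns.2 <= t} &
      forall x : rat, unpickle ns.1 = Some x ->
        (exists y, (x, y) \in t) /\ (exists z, (z, x) \in t)].
  case: ns => n s /=; have [iso|] := classic (partial_iso s); last by exists s.
  case: (unpickle n) => [x|]; last by exists s => _; split.
  have [t [? ? fx gx]] := partial_iso_extend x iso.
  by exists t => _; split=> // _ [<-].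
pose chain := fix chain n := if n is m.+1 then next (m, chain m) else s0.
have iso n : partial_iso (chain n).
  by elim: n => //= n /(nextP (n, chain n))[].
have sub m n : (m <= n)%N -> {subset chain m <= chain n}.
  elim: n => [|n IH]; first by rewrite leqn0 => /eqP->.
  rewrite leq_eqVlt => /orP[/eqP->//|/IH mn] p /mn pn.
  by have [_ + _] := nextP (n, chain n) (iso n); apply.
(* The union of the chain is the graph of the automorphism; any two of its pairs already occur
   together at one stage. *)
pose rel x y := exists n, (x, y) \in chain n.
have rel_adm x y : rel x y -> admissible_pair (x, y).
  by move=> [n]; have [+ _] := iso n; apply.
have rel_cmp x y x' y' : rel x y -> rel x' y' ->
    order_compatible (x, y) (x', y').
  move=> [m xym] [n xyn]; have [_ +] := iso (maxn m n); apply.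
    by apply: sub xym; apply: leq_maxl.
  by apply: sub xyn; apply: leq_maxr.
have rel_stage x : (exists y, rel x y) /\ (exists z, rel z x).
  have [_ _] := nextP (pickle x, chain (pickle x)) (iso _).
  move=> /(_ x (pickleK x))[[y xy] [z zx]].
  by split; [exists y|exists z]; exists (pickle x).+1.
have /functional_choice[f fP] x : exists y, rel x y by case: (rel_stage x).
have /functional_choice[g gP] x : exists z, rel z x by case: (rel_stage x).
exists f, g; split=> [x|y|x y|x|p ps].
- have [/= e1 e2] := rel_cmp _ _ _ _ (fP x) (gP (f x)).
  by apply/eqP; rewrite eq_le !leNgt e1 e2 ltxx.
- have [/= e1 e2] := rel_cmp _ _ _ _ (fP (g y)) (gP y).
  by apply/eqP; rewrite eq_le !leNgt -e1 -e2 ltxx.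
- by have [/= <-] := rel_cmp _ _ _ _ (fP x) (fP y).
- by have [/= ->] := rel_adm _ _ (fP x).
- have relp : rel p.1 p.2 by exists 0; rewrite /= -surjective_pairing.
  have [/= e1 e2] := rel_cmp _ _ _ _ (fP p.1) relp.
  by apply/eqP; rewrite eq_le !leNgt -e1 -e2 ltxx.
Qed.

End BackAndForth.

Lemma rat_no_finite_distinguishing (D : finType) (c : rat -> D) :
  exists f g : rat -> rat,
    [/\ cancel f g, cancel g f, {mono f : x y / x < y},
        forall x, c (f x) = c x & exists x, f x <> x].
Proof.
have [a [b [ltab dense]]] := exists_colours_dense c.
pose x := (a + b) / 2.
have xI : a < x < b by rewrite /x; lra.
(* The seed pair [(x, y)] with [x < y] makes the automorphism move [x]. *)
have [|||y xyb cyx] := dense x xI x b; [lra|lra|lra|].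
have iso0 : partial_iso c a b [:: (x, y)].
  apply: partial_iso_cons => //; split=> //=; left; split=> //; lra.
have [f [g [fK gK fmono fc fx]]] := partial_iso_total dense iso0.
exists f, g; split=> //; exists x.
by rewrite (fx (x, y)) ?mem_head //= => yx; move: xyb; rewrite yx ltxx.
Qed.

(** * The graph: connectedness and arc transitivity *)

(* The Boolean is [true] on the upper copy of the rationals. *)
Definition two_rat_adj (u v : bool * rat) : Prop :=
  match u, v with
  | (false, q), (true, r) => q < r
  | (true, r), (false, q) => q < r
  | _, _ => False
  end.

Lemma two_rat_simple : simple_graph two_rat_adj.
Proof. by split=> [[[] x] [[] y]|[[] x]] //= ?. Qed.

(** Vertices of different copies are joined by a path of length three through an upper vertex above
    both and a lower vertex below both; within one copy, two such paths are joined. *)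
Lemma two_rat_connected : connected_graph two_rat_adj.
Proof.
have bounds (x y : rat) : exists z t, [/\ z < x, z < y, x < t & y < t].
  have [lexy|ltyx] := leP x y; first by exists (x - 1), (y + 1); split; lra.
  by exists (y - 1), (x + 1); split; lra.
have up x y : clos_refl_trans _ two_rat_adj (false, x) (true, y).
  have [z [t [zx zy xt yt]]] := bounds x y.
  apply: (@rt_trans _ _ _ (true, t)); first exact: rt_step.
  by apply: (@rt_trans _ _ _ (false, z)); apply: rt_step => //=; lra.
have down x y : clos_refl_trans _ two_rat_adj (true, x) (false, y).
  have [z [t [zx zy xt yt]]] := bounds x y.
  apply: (@rt_trans _ _ _ (false, z)); first exact: rt_step.
  by apply: (@rt_trans _ _ _ (true, t)); apply: rt_step => //=; lra.
move=> [[] x] [[] y] //.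
  exact: rt_trans (down x x) (up x y).
exact: rt_trans (up x x) (down x y).
Qed.

Lemma two_rat_affine_automorphism (k d : rat) : k != 0 ->
  automorphism two_rat_adj (fun v => (v.1 (+) (k < 0), k * v.2 + d)).
Proof.
move=> k0; split.
  exists (fun v => (v.1 (+) (k < 0), (v.2 - d) / k)) => -[s x] /=.
    by rewrite -addbA addbb addbF addrK mulrC mulKf.
  by rewrite -addbA addbb addbF mulrC divfK // subrK.
move=> [s x] [t y] /=; have [kneg|kpos|k00] := ltgtP k 0;
  last by rewrite k00 eqxx in k0.
  by case: s t => [] [] //=; rewrite ltrD2r ltr_nM2l.
by case: s t => [] [] //=; rewrite ltrD2r ltr_pM2l.
Qed.

(** The sign of [y - x] tells in which copy an arc starts, so the sign of the slope between two arcs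
    tells whether the copies must be exchanged. *)
Lemma two_rat_adjP s x t y : two_rat_adj (s, x) (t, y) ->
  [/\ t = ~~ s, y - x != 0 & (y - x < 0) = s].
Proof.
rewrite subr_eq0 subr_lt0.
by case: s t => [] [] //= h; split; rewrite // ?(lt_eqF h) ?(gt_eqF h) ?(lt_gtF h).
Qed.

Lemma two_rat_arc_transitive : arc_transitive two_rat_adj.
Proof.
move=> [s x] [t y] [s' x'] [t' y'].
move=> /two_rat_adjP[-> yx yxs] /two_rat_adjP[-> yx' yxs'].
(* The slope of the affine map taking [x] to [x'] and [y] to [y']. *)
pose k := (y' - x') / (y - x).
have k0 : k != 0 by rewrite mulf_neq0 ?invr_eq0.
have kE : k * (y - x) = y' - x' by rewrite divfK.
have kneg : (k < 0) = s' (+) s.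
  by rewrite mulr_lt0 invr_eq0 invr_lt0 yx yx' yxs yxs'.
exists (fun v => (v.1 (+) (k < 0), k * v.2 + (x' - k * x))).
split; first exact: two_rat_affine_automorphism.
rewrite kneg /=; split; congr pair.
- by rewrite addbC addbK.
- ring.
- by case: s s' {kneg yxs yxs'} => [] [].
- by rewrite addrCA -mulrBr kE addrC subrK.
Qed.

(** * Infinite motion *)

Lemma exists_between_notin (s : seq rat) (x y : rat) : x < y ->
  exists2 z, x < z < y & z \notin s.
Proof.
elim: s x y => [|w s IH] x y xy.
  by exists ((x + y) / 2) => //; lra.
pose m := (x + y) / 2.
have [lewm|ltmw] := leP w m.
  have [|z zI zs] := IH m y; first by rewrite /m; lra.
  exists z; first by rewrite /m in zI; lra.
  by rewrite inE negb_or zs andbT; apply/eqP => zw; lra.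
have [|z zI zs] := IH x m; first by rewrite /m; lra.
exists z; first by rewrite /m in zI; lra.
by rewrite inE negb_or zs andbT; apply/eqP => zw; lra.
Qed.

(** For [u] and [v] in one copy, points of the other copy strictly between them are adjacent to
    exactly one of the two. Otherwise take neighbours of [u]: they lie in the copy of [v]. *)
Lemma two_rat_neighbourhoods_differ (l : seq (bool * rat)) u v : u <> v ->
  exists2 w, w \notin l & ~ (two_rat_adj u w <-> two_rat_adj v w).
Proof.
have mem_snd b z : z \notin map snd l -> (b, z) \notin l.
  by apply: contra => bz; apply/mapP; exists (b, z).
move: u v => [s x] [t y]; have [<-|] := eqVneq s t => uv.
  have {uv} : x != y by apply/eqP => xy; apply: uv; rewrite xy.
  wlog ltxy : x y / x < y => [wlogH neq|_].
    have [ltxy|ltyx|eqxy] := ltgtP x y; last by rewrite eqxy eqxx in neq.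
      exact: wlogH.
    have [|w wl diff] := wlogH _ _ ltyx; first by rewrite eq_sym.
    by exists w => // -[? ?]; apply: diff.
  have [z zI zl] := exists_between_notin (map snd l) ltxy.
  exists (~~ s, z); first exact: mem_snd.
  by case: s => /= -[]; lra.
move=> _; have -> : t = ~~ s by case: s t uv => [] [].
have [z zI zl] : exists2 z, (if s then x - 1 < z < x else x < z < x + 1) &
    z \notin map snd l.
  by case: s {uv} => /=; apply: exists_between_notin; lra.
exists (~~ s, z); first exact: mem_snd.
by case: s zI {uv} => /= zI []; lra.
Qed.

(** If all moved vertices lie in [l], a vertex [w] outside [l] is fixed, so it is adjacent to [v]
    iff it is adjacent to [phi v]. *)
Lemma two_rat_infinite_motion : infinite_motion two_rat_adj.
Proof.
move=> phi [_ phi_adj] [v phiv] [l moved].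
have [w wl diff] := two_rat_neighbourhoods_differ l phiv.
have phiw : phi w = w.
  apply: NNPP => /moved wIl; move/negP: wl; apply.
  by elim: l wIl {moved} => //= x l IH [->|/IH xl]; rewrite inE ?eqxx // xl orbT.
by apply: diff; have := phi_adj v w; rewrite phiw => -[? ?]; split.
Qed.

(** * Finite colourings of the graph *)

Lemma two_rat_no_finite_distinguishing (C : finType) (c : bool * rat -> C) :
  ~ distinguishing two_rat_adj c.
Proof.
move=> dist.
(* Pairing the colours of the two copies of [x] lets one [f] preserve both when it acts on each
   copy. *)
have [f [g [fK gK fmono fc [x fx]]]] :=
  rat_no_finite_distinguishing (fun x => (c (false, x), c (true, x))).
apply: fx; pose phi (v : bool * rat) := (v.1, f v.2).
have /(_ (false, x))[//] : forall v, phi v = v.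
apply: dist => [|[[] y]]; [|by have [] := fc y|by have [] := fc y].
split=> [|[[] y] [[] z]] //=; rewrite ?fmono //.
by exists (fun v => (v.1, g v.2)) => -[s y]; rewrite /phi /= ?fK ?gK.
Qed.

Theorem theorem2 :
  exists (V : Type) (adj : V -> V -> Prop),
    simple_graph adj /\ countable_type V /\ connected_graph adj /\
    arc_transitive adj /\ infinite_motion adj /\
    forall (C : finType) (c : V -> C), ~ distinguishing adj c.
Proof.
exists (bool * rat)%type, two_rat_adj.
split; first exact: two_rat_simple.
split; first by exists pickle; apply: pcan_inj pickleK.
split; first exact: two_rat_connected.
split; first exact: two_rat_arc_transitive.
split; first exact: two_rat_infinite_motion.
exact: two_rat_no_finite_distinguishing.
Qed.
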